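(* Let $G$ be a finite connected graph, and let $\underline{d}$ be a divisor on $G$ that is not effective but whose linear equivalence class $\delta$ is effective. Let $V \subset V(G)$ be the set of vertices on which $\underline{d}$ has negative coefficients. Then \[W_{\mathrm{Dhar}}(\underline{d}, V) \neq \emptyset.\]
   Context: $G$ is a finite connected vertex-weighted graph (weights $g_v\in\mathbb{Z}_{\ge 0}$), multiple edges and loops allowed, with vertex set $V(G)$. A divisor is a formal sum $\underline{d}=\sum_{v\in V(G)}\underline{d}_v\, v$ with $\underline{d}_v\in\mathbb{Z}$. It is effective if $\underline{d}_v\ge 0$ for all $v$, and effective away from $V\subset V(G)$ if $\underline{d}_v\ge 0$ for all $v\notin V$. For $f:V(G)\to\mathbb{Z}$, $\mathrm{div}(f)$ is the divisor with $\mathrm{div}(f)_v=\sum_{e=vw}(f(w)-f(v))$, the sum running over all edges $e$ adjacent to $v$ (loops contribute $0$). Two divisors are linearly equivalent if they differ by $\mathrm{div}(f)$ for some $f:V(G)\to\mathbb{Z}$. A linear equivalence class is effective if it contains an effective divisor. The divisor obtained from $\underline{d}$ by a chip-firing move along $W\subset V(G)$ is $\underline{d}+\mathrm{div}(\mathbb{1}_W)$, with $\mathbb{1}_W$ the characteristic function of $W$. Dhar decomposition: let $V\subset V(G)$ be non-empty and $\underline{d}$ effective away from $V$. Define $V=V_0\subset V_1\subset\cdots$ by letting $V_{i+1}$ be the union of $V_i$ and the set of those vertices in $V(G)\setminus V_i$ on which $\underline{d}+\mathrm{div}(\mathbb{1}_{V(G)\setminus V_i})$ is negative. The sequence stabilizes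 at some $V_n=V_{n+1}$, and $W_{\mathrm{Dhar}}(\underline{d},V):=V(G)\setminus V_n$. *)

(* Defs.v *)
From HB Require Import structures.
From mathcomp Require Import all_boot all_order all_algebra.

Set Implicit Arguments.
Unset Strict Implicit.
Unset Printing Implicit Defensive.

Import Order.TTheory GRing.Theory Num.Theory.
Local Open Scope ring_scope.

(** Finite vertex-weighted graphs; loops and multiple edges are allowed.  The
    two ends of an edge are stored in an arbitrary order, on which nothing below
    depends: the graph is undirected. *)
Record graph := Graph {
  vertex : finType;
  edge : finType;
  end1 : edge -> vertex;
  end2 : edge -> vertex;
  weight : vertex -> nat
}.

Section Graph.

Variable G : graph.

Definition divisor : Type := {ffun vertex G -> int}.

Implicit Types (d : divisor) (V W : {set vertex G}).

Definition incident (v : vertex G) (e : edge G) : bool :=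
  (end1 e == v) || (end2 e == v).

(** For [e] incident to [v], the other end of [e]; this is [v] for a loop. *)
Definition opposite (v : vertex G) (e : edge G) : vertex G :=
  if end1 e == v then end2 e else end1 e.

Definition adjacent : rel (vertex G) :=
  fun v w => [exists e, incident v e && (opposite v e == w)].

Definition connected : Prop :=
  (0 < #|vertex G|)%N /\ forall v w : vertex G, connect adjacent v w.

Definition effective d : Prop := forall v, 0 <= d v.

Definition div (f : vertex G -> int) : divisor :=
  [ffun v => \sum_(e | incident v e) (f (opposite v e) - f v)].

Definition lin_equiv d d' : Prop :=
  exists f : vertex G -> int, d' - d = div f.

Definition lin_class d : divisor -> Prop := lin_equiv d.

Definition effective_class (delta : divisor -> Prop) : Prop :=
  exists d, delta d /\ effective d.

Definition indicator W (v : vertex G) : int := (v \in W)%:R.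

Definition chip_fire d W : divisor := d + div (indicator W).

Definition dhar_step d V : {set vertex G} :=
  V :|: [set v in ~: V | chip_fire d (~: V) v < 0].

Definition dhar_seq d V (i : nat) : {set vertex G} := iter i (dhar_step d) V.

Lemma dhar_seq_stabilizes d V :
  exists n, dhar_seq d V n == dhar_seq d V n.+1.
Proof.
case: (boolP [exists n : 'I_(#|vertex G|.+1),
         dhar_seq d V n == dhar_seq d V n.+1]) => [/existsP[n Hn]|].
  by exists n.
rewrite negb_exists => /forallP ne.
suff H n : (n <= #|vertex G|.+1)%N -> (n <= #|dhar_seq d V n|)%N.
  by have := leq_trans (H _ (leqnn _)) (max_card _); rewrite ltnn.
elim: n => // n IHn ltn.
apply: leq_ltn_trans (IHn (ltnW ltn)) _; apply: proper_card.
by rewrite properEneq (ne (Ordinal ltn)) /= subsetUl.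
Qed.

(** The stable set, taken at the first [n] with [V_n = V_(n+1)].  As a total
    function it is the Dhar decomposition when [V] is non-empty and [d] is
    non-negative outside [V]; both hold for [V = [set v | d v < 0]] when [d] is
    not effective. *)
Definition dhar_limit d V : {set vertex G} :=
  dhar_seq d V (ex_minn (dhar_seq_stabilizes d V)).

Definition W_Dhar d V : {set vertex G} := ~: dhar_limit d V.

End Graph.

(* Main.v *)
(** If [d + div f] is effective, the set [M] where [f] is maximal is never burnt:
    as long as the burnt set [U] misses [M], each edge at a vertex of [M] costs
    that vertex at most as many chips when firing the complement of [U] as when
    firing [f], so the vertex stays out of debt. *)
Require Import Defs.
From HB Require Import structures.
From mathcomp Require Import all_boot all_order all_algebra.
From mathcomp Require Import zify.

Set Implicit Arguments.
Unset Strict Implicit.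
Unset Printing Implicit Defensive.

Import Order.TTheory GRing.Theory Num.Theory.
Local Open Scope ring_scope.

Section Maximum.

Variables (G : graph) (d : divisor G) (f : vertex G -> int) (v0 : vertex G).
Hypothesis f_max : forall v, f v <= f v0.
Hypothesis eff : effective (d + div f).

(** Compare edge by edge: towards [W] the right-hand term is 0 and the left one is at most 0; out of
    [W] the right-hand term is -1, and [f] drops by at least 1 because it is integer-valued. *)
Lemma div_le_div_indicator (W : {set vertex G}) (v : vertex G) :
  (forall w, f w = f v0 -> w \in W) -> f v = f v0 ->
  div f v <= div (indicator W) v.
Proof.
move=> argmaxW fv; rewrite !ffunE; apply: ler_sum => e _.
rewrite /indicator (argmaxW v fv) fv; set w := opposite v e.
have := f_max w; case: (boolP (w \in W)) => [_|wW] fw; first by lia.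
have : f w <> f v0 by move=> /argmaxW; rewrite (negbTE wW).
by lia.
Qed.

Lemma chip_fire_ge0_argmax (W : {set vertex G}) (v : vertex G) :
  (forall w, f w = f v0 -> w \in W) -> f v = f v0 -> 0 <= chip_fire d W v.
Proof.
move=> argmaxW fv; have := eff v; rewrite /chip_fire !ffunE => /le_trans; apply.
by have := div_le_div_indicator argmaxW fv; rewrite !ffunE lerD2l.
Qed.

(** Base case of the burning induction: firing all vertices at once leaves [d] unchanged. *)
Lemma argmax_divisor_ge0 (v : vertex G) : f v = f v0 -> 0 <= d v.
Proof.
move=> fv; have := chip_fire_ge0_argmax (fun w _ => in_setT w) fv.
by rewrite /chip_fire !ffunE big1 ?addr0 // => e _; rewrite /indicator !inE subrr.
Qed.

Lemma argmax_notin_dhar_seq (i : nat) (v : vertex G) :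
  f v = f v0 -> v \notin dhar_seq d [set u | d u < 0] i.
Proof.
(* [v] stays general: the step needs every maximum point of [f] to be unburnt at stage [i]. *)
elim: i v => [|i IHi] v fv; first by rewrite inE -leNgt argmax_divisor_ge0.
rewrite [dhar_seq _ _ _]/= /dhar_step -/(dhar_seq _ _ _) in_setU negb_or IHi //=.
rewrite in_set negb_and -leNgt chip_fire_ge0_argmax ?orbT // => w fw.
by rewrite in_setC IHi.
Qed.

End Maximum.

Theorem proposition1p2 (G : graph) (G_connected : connected G)
    (d : divisor G) (d_not_effective : ~ effective d)
    (delta : divisor G -> Prop) (delta_class : delta = lin_class d)
    (delta_effective : effective_class delta)
    (V : {set vertex G}) (V_def : V = [set v | d v < 0]) :
  W_Dhar d V <> set0.
Proof.
move: delta_effective; rewrite delta_class V_def => -[d' [[f df] d'_eff]].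
have eff : effective (d + div f) by rewrite -df addrC subrK.
have [/card_gt0P[u _] _] := G_connected.
case: (@Order.TotalTheory.arg_maxP _ _ _ u predT f isT) => v0 _ f_max.
move=> /setP/(_ v0); rewrite in_setC in_set0 => /negP; apply; apply/negP.
(* The stable set is by definition a term of the sequence, so it misses [v0]. *)
exact: (argmax_notin_dhar_seq (fun v => f_max v isT) eff).
Qed.
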